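(* Let $\tau>0$, $B>0$, $\alpha\in[0,1]$, $\lambda\in\mathbb{R}\setminus\{0\}$ and ${\cal D}_\lambda(x)=B\,e^{\lambda|x|}$, $x\in\mathbb{R}$. Consider the heterogeneous Cattaneo-Vernotte equation $$\tau\,\partial_t^2 p(x,t)+\partial_t p(x,t)=\partial_x\Big\{{\cal D}_\lambda(x)^{1-\alpha}\,\partial_x\big[{\cal D}_\lambda(x)^{\alpha}p(x,t)\big]\Big\},\qquad x\in\mathbb{R},\ t>0,$$ with $p(x,0)=\delta(x)$, $\partial_t p(x,t)|_{t=0}=0$ and $\lim_{x\to\pm\infty}p(x,t)=0$. In the Laplace domain (variable $s>0$ dual to $t$) this problem reads $$(\tau s^2+s)\,\widehat p(x,s)-(\tau s+1)\,\delta(x)=\partial_x\Big\{{\cal D}_\lambda(x)^{1-\alpha}\,\partial_x\big[{\cal D}_\lambda(x)^{\alpha}\widehat p(x,s)\big]\Big\},\qquad \lim_{x\to\pm\infty}\widehat p(x,s)=0 .$$ It is solved by the following functions: if $\lambda>0$, by $$\widehat p_{\lambda;1}(\alpha;x,s)=\frac{1}{2\sqrt B}\,e^{-\frac{\lambda}{2}(1+\alpha)|x|}\;\frac{\tau s+1}{\sqrt{\tau s^2+s}}\;\frac{I_{\alpha-1}\!\left(\frac{2}{\lambda\sqrt B}\,e^{-\lambda|x|/2}\sqrt{\tau s^2+s}\right)}{I_{\alpha}\!\left(\frac{2}{\lambda\sqrt B}\sqrt{\tau s^2+s}\right)},$$ and if $\lambda<0$, by $$\widehat p_{\lambda;2}(\alpha;x,s)=\frac{1}{2\sqrt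 B}\,e^{\frac{|\lambda|}{2}(1+\alpha)|x|}\;\frac{\tau s+1}{\sqrt{\tau s^2+s}}\;\frac{K_{\alpha-1}\!\left(\frac{2}{|\lambda|\sqrt B}\,e^{|\lambda x|/2}\sqrt{\tau s^2+s}\right)}{K_{\alpha}\!\left(\frac{2}{|\lambda|\sqrt B}\sqrt{\tau s^2+s}\right)}.$$
   Context: $I_\nu$ and $K_\nu$ denote the modified Bessel functions of the first and second kind of order $\nu$. The Laplace transform is $\widehat p(x,s)=\int_0^\infty e^{-st}p(x,t)\,dt$, and $\delta$ is the Dirac delta; the Laplace-domain equation is understood in the sense of distributions in $x$ for each fixed $s>0$. *)

(* Defs.v *)
From HB Require Import structures.
From mathcomp Require Import all_boot all_order all_algebra.
From mathcomp Require Import all_classical all_reals all_analysis.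
Set Implicit Arguments.
Unset Strict Implicit.
Unset Printing Implicit Defensive.
Import Order.TTheory GRing.Theory Num.Theory numFieldNormedType.Exports.
Local Open Scope classical_set_scope.
Local Open Scope ring_scope.

(* 1 / Gamma(x) by Gauss's limit
     Gamma(x) = lim_n n! n^x / (x (x + 1) ... (x + n)),
   valid for every real x; it gives 1 / Gamma(x) = 0 at x = 0, -1, -2, ...,
   which is the convention needed in the series of I_(-1). *)
Definition rgamma (R : realType) (x : R) : R :=
  limn (fun n : nat =>
    (\prod_(k < n.+1) (x + k%:R)) / (n`!%:R * n%:R `^ x)).

(* I_nu(z) = sum_m (z/2)^(2m + nu) / (m! Gamma(m + nu + 1)),  nu real, z > 0. *)
Definition besselI (R : realType) (nu z : R) : R :=
  limn (series (fun m : nat =>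
    (z / 2) `^ (2 * m%:R + nu) / m`!%:R * rgamma (m%:R + nu + 1))).

Definition cosh (R : realType) (t : R) : R := (expR t + expR (- t)) / 2.

(* K_nu(z) = int_0^oo exp(- z cosh t) cosh (nu t) dt,  nu real, z > 0; unlike
   (pi/2) (I_(-nu) - I_nu) / sin (nu pi), this needs no passage to the limit
   at the integer orders. *)
Definition besselK (R : realType) (nu z : R) : R :=
  \int[@lebesgue_measure R]_(t in `[0, +oo[)
    (expR (- z * cosh t) * cosh (nu * t)).

(* Test functions on the line: smooth with compact support. *)
Definition test_function (R : realType) (phi : R -> R) : Prop :=
  (forall (n : nat) (x : R), derivable (phi^`(n))%classic x 1) /\
  (exists M : R, forall x : R, M < `|x| -> phi x = 0).

(* A distribution is handled through its pairing with test functions; its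
   values at other arguments are irrelevant, see [eq_distr]. *)
Definition distr (R : realType) := (R -> R) -> R.

Definition eq_distr (R : realType) (S T : distr R) : Prop :=
  forall phi : R -> R, test_function phi -> S phi = T phi.

Definition regular_distr (R : realType) (f : R -> R) : distr R :=
  fun phi => \int[@lebesgue_measure R]_x (f x * phi x).

Definition delta_distr (R : realType) : distr R := fun phi => phi 0.

Definition derive_distr (R : realType) (T : distr R) : distr R :=
  fun phi => - T (phi^`())%classic.

(* The distributional derivative of u is the locally integrable function v. *)
Definition weak_derivative (R : realType) (u v : R -> R) : Prop :=
  [/\ locally_integrable setT u, locally_integrable setT v &
      eq_distr (derive_distr (regular_distr u)) (regular_distr v)].

Definition diffusivity (R : realType) (B lambda x : R) : R :=
  B * expR (lambda * `|x|).

(* phat = phat(., s) solves, in the sense of distributions in x,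
     (tau s^2 + s) phat - (tau s + 1) delta
        = d/dx { D^(1 - alpha) d/dx [ D^alpha phat ] }
   and tends to 0 at both infinities. As D^(1 - alpha) is not smooth at 0, the
   product on the right only makes sense when the inner distributional
   derivative is a locally integrable function v; such a v is unique a.e., so
   the outer derivative does not depend on its choice. *)
Definition laplace_CV_solution (R : realType) (tau B alpha lambda s : R)
    (phat : R -> R) : Prop :=
  let D := diffusivity B lambda in
  [/\ locally_integrable setT phat,
      exists v : R -> R,
        weak_derivative (fun x => D x `^ alpha * phat x) v /\
        eq_distr
          (fun phi => (tau * s ^+ 2 + s) * regular_distr phat phi
                      - (tau * s + 1) * delta_distr phi)
          (derive_distr (regular_distr (fun x => D x `^ (1 - alpha) * v x))),
      phat x @[x --> +oo] --> 0 &
      phat x @[x --> -oo] --> 0].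

Definition phat1 (R : realType) (tau B alpha lambda x s : R) : R :=
  1 / (2 * Num.sqrt B) * expR (- (lambda / 2) * (1 + alpha) * `|x|)
  * ((tau * s + 1) / Num.sqrt (tau * s ^+ 2 + s))
  * (besselI (alpha - 1)
       (2 / (lambda * Num.sqrt B) * expR (- lambda * `|x| / 2)
        * Num.sqrt (tau * s ^+ 2 + s))
     / besselI alpha
       (2 / (lambda * Num.sqrt B) * Num.sqrt (tau * s ^+ 2 + s))).

Definition phat2 (R : realType) (tau B alpha lambda x s : R) : R :=
  1 / (2 * Num.sqrt B) * expR (`|lambda| / 2 * (1 + alpha) * `|x|)
  * ((tau * s + 1) / Num.sqrt (tau * s ^+ 2 + s))
  * (besselK (alpha - 1)
       (2 / (`|lambda| * Num.sqrt B) * expR (`|lambda * x| / 2)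
        * Num.sqrt (tau * s ^+ 2 + s))
     / besselK alpha
       (2 / (`|lambda| * Num.sqrt B) * Num.sqrt (tau * s ^+ 2 + s))).

(* Main.v *)
(** Away from 0 the equation is an ODE which, in the variable
    [z ~ expR (- lambda |x| / 2)], splits into the two first-order identities
    [(z^(1 - alpha) I_(alpha - 1))' = z^(1 - alpha) I_alpha] and
    [(z^alpha I_alpha)' = z^alpha I_(alpha - 1)]: the first gives the weak
    derivative of [D^alpha phat], the second the derivative of the flux. They
    are read off the power series, and for [K] (with opposite signs) off the
    integral representation, by differentiation under the integral and one
    integration by parts. The flux is an odd function of [x] whose jump at 0 is
    [- (tau s + 1)] by the choice of the denominator of [phat]; integration by
    parts against a test function on each half-line turns this jump into the
    delta. *)

Require Import Defs.
From HB Require Import structures.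
From mathcomp Require Import all_boot all_order all_algebra.
From mathcomp Require Import ring lra.
From mathcomp Require Import all_classical all_reals all_analysis.
From mathcomp Require Import measurable_realfun.
Import Order.TTheory GRing.Theory Num.Theory numFieldNormedType.Exports.
Local Open Scope classical_set_scope.
Local Open Scope ring_scope.
Set Implicit Arguments.
Unset Strict Implicit.
Unset Printing Implicit Defensive.

(** * Distributions given by functions smooth on each half-line *)

(** Both branches are functions on the whole line, so every regularity hypothesis can be global and
    two-sided, without one-sided derivatives at 0. *)
Definition glue (R : realType) (f g : R -> R) (x : R) : R :=
  if x < 0 then g x else f x.

Lemma is_derive1_continuous (R : realType) (F f : R -> R) :
  (forall x : R, is_derive x 1 F (f x)) -> continuous F.
Proof.
by move=> dF x; apply/differentiable_continuous/derivable1_diffP; exact: ex_derive.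
Qed.

Section glue.
Context {R : realType}.
Implicit Types (f g u w phi F : R -> R) (x : R).
Local Notation mu := (@lebesgue_measure R).

Lemma measurable_fun_glue f g :
  continuous f -> continuous g -> measurable_fun setT (glue f g).
Proof.
move=> cf cg; apply: measurable_fun_ifT.
- exact: measurable_fun_ltr.
- exact: continuous_measurable_fun.
- exact: continuous_measurable_fun.
Qed.

Lemma continuous_itv_integrable f (a b : R) :
  continuous f -> mu.-integrable `[a, b] (EFin \o f).
Proof.
move=> cf; apply: continuous_compact_integrable; first exact: segment_compact.
exact: continuous_subspaceT.
Qed.

(** The continuous function [|f| + |g|] dominates the glued one, whatever happens at 0. *)
Lemma glue_itv_integrable f g (a b : R) : continuous f -> continuous g ->
  mu.-integrable `[a, b] (EFin \o glue f g).
Proof.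
move=> cf cg.
have cn : continuous (fun x => `|f x| + `|g x|).
  by move=> x; apply: cvgD; apply: cvg_norm; [exact: cf|exact: cg].
apply: le_integrable (@continuous_itv_integrable _ a b cn) => //.
  apply/measurable_EFinP; apply: measurable_funTS; exact: measurable_fun_glue.
move=> x _ /=; rewrite lee_fin [leRHS]ger0_norm ?addr_ge0//.
by rewrite /glue; case: ifP => _; rewrite ?lerDl ?lerDr.
Qed.

Lemma glue_locally_integrable f g : continuous f -> continuous g ->
  locally_integrable setT (glue f g).
Proof.
move=> cf cg; split; [exact: measurable_fun_glue|exact: openT|move=> K _ cK].
have [M [_ /(_ (M + 1))]] := compact_bounded cK.
rewrite ltrDl ltr01 => /(_ isT) KM.
have /integrableP[_] := @glue_itv_integrable _ _ (- (M + 1)) (M + 1) cf cg.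
apply: le_lt_trans; apply: ge0_subset_integral => //.
- exact: compact_measurable.
- apply: measurable_funTS; apply/measurable_EFinP.
  by apply: measurableT_comp => //; exact: measurable_fun_glue.
- by move=> x Kx /=; rewrite in_itv/= -ler_norml; exact: KM.
Qed.

Section compact_support.
Variable M : R.
Hypothesis M0 : 0 < M.

Lemma integral_glueE f g : continuous f -> continuous g ->
  (forall x, M < `|x| -> glue f g x = 0) ->
  mu.-integrable setT (EFin \o glue f g) /\
  \int[mu]_x (glue f g x) =
    \int[mu]_(x in `[- M, 0]) g x + \int[mu]_(x in `[0, M]) f x.
Proof.
move=> cf cg G0.
have GE : glue f g \_ `[- M, M] = glue f g.
  apply/funext => x; rewrite patchE; case: ifPn => // xM; rewrite G0// ltNge.
  by apply: contra xM; rewrite ler_norml => xM; rewrite inE/= in_itv.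
split.
  rewrite -GE -restrict_EFin.
  by apply/(integrable_mkcond _ _).1 => //; exact: glue_itv_integrable.
rewrite -GE -Rintegral_mkcond.
have M0M : `[- M, M]%classic = `[- M, 0[%classic `|` `[0, M]%classic.
  by rewrite -itv_bndbnd_setU ?bnd_simp// ?ltW// oppr_lt0.
have sub b : [set` Interval (BLeft (- M)) (BSide b 0)] `<=` `[- M, M].
  by apply: subset_itvl; case: b; rewrite bnd_simp// ltW.
rewrite M0M Rintegral_setU//=; first last.
- rewrite disj_set2E; apply/eqP/seteqP; split => // x /=.
  by rewrite !in_itv/= => -[/andP[_ x0] /andP[/le_lt_trans/(_ x0)]]; rewrite ltxx.
- by rewrite -M0M; exact: glue_itv_integrable.
congr (_ + _).
  (* [glue f g] takes the value [f 0] at 0, so this null endpoint is dropped from the integral of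
     [g] before the integrands are compared. *)
  rewrite -Rintegral_itv_bndo_bndc; last first.
    apply: integrableS (@continuous_itv_integrable _ (- M) M cg) => //.
  apply: eq_Rintegral => x; rewrite inE/= in_itv/= => /andP[_ x0].
  by rewrite /glue x0.
apply: eq_Rintegral => x; rewrite inE/= in_itv/= => /andP[x0 _].
by rewrite /glue ltNge x0.
Qed.

End compact_support.

Lemma Rintegral_continuous_FTC2 F f (a b : R) : a < b -> continuous f ->
  (forall x, is_derive x 1 F (f x)) ->
  \int[mu]_(x in `[a, b]) f x = F b - F a.
Proof.
move=> ab cf dF; have cF := is_derive1_continuous dF.
rewrite /Rintegral (@continuous_FTC2 _ f F)//.
- exact: continuous_subspaceT.
- split; first by move=> x _; exact: ex_derive.
  + exact/cvg_at_right_filter/cF.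
  + exact/cvg_at_left_filter/cF.
- by move=> x _; rewrite derive1E derive_val.
Qed.

Lemma test_function_is_derive phi x : test_function phi ->
  is_derive x 1 phi (derive1 phi x).
Proof.
by move=> [dphi _]; rewrite derive1E; apply: DeriveDef => //; exact: (dphi 0%N x).
Qed.

Lemma test_function_continuous_derive phi : test_function phi ->
  continuous (derive1 phi).
Proof.
move=> [dphi _] x; apply/differentiable_continuous/derivable1_diffP.
exact: (dphi 1%N x).
Qed.

(** The bound is enlarged so that it is positive and [phi] vanishes at [M] and [- M] themselves,
    where the boundary terms of the integration by parts are evaluated. *)
Lemma test_function_support phi : test_function phi ->
  exists2 M, 0 < M & forall x, M <= `|x| -> phi x = 0.
Proof.
move=> [_ [M0 phi0]]; exists (Num.max M0 0 + 1).
  by rewrite ltr_wpDl// le_max lexx orbT.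
move=> x Mx; apply: phi0; apply: lt_le_trans Mx.
by rewrite (@le_lt_trans _ _ (Num.max M0 0)) ?ltrDl// le_max lexx.
Qed.

Lemma glueM_integrable f g phi M : 0 < M ->
  continuous f -> continuous g -> continuous phi ->
  (forall x, M < `|x| -> phi x = 0) ->
  mu.-integrable setT (EFin \o (fun x => glue f g x * phi x)).
Proof.
move=> M_gt0 cf cg cphi phi0.
have E : (fun x => glue f g x * phi x) =
    glue (fun x => f x * phi x) (fun x => g x * phi x).
  by apply/funext => x; rewrite /glue; case: ifP.
rewrite E; apply: (integral_glueE M_gt0 _ _ _).1.
- by move=> x; apply: cvgM; [exact: cf|exact: cphi].
- by move=> x; apply: cvgM; [exact: cg|exact: cphi].
- by move=> x Mx; rewrite /glue phi0// !mulr0 if_same.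
Qed.

Lemma regular_distr_glue_integrable f g phi : test_function phi ->
  continuous f -> continuous g ->
  mu.-integrable setT (EFin \o (fun x => glue f g x * phi x)).
Proof.
move=> tphi cf cg; have [M M_gt0 phi0] := test_function_support tphi.
apply: (glueM_integrable M_gt0) => //; last by move=> x /ltW/phi0.
by apply: is_derive1_continuous => x; exact: test_function_is_derive.
Qed.

(** Integration by parts on each half-line: the boundary terms at [M] and [- M] vanish, and those at
    0 are [g 0 * phi 0] from the left and [- f 0 * phi 0] from the right. *)
Lemma regular_distr_glue f g u w phi : test_function phi ->
  (forall x, is_derive x 1 f (u x)) -> (forall x, is_derive x 1 g (w x)) ->
  continuous u -> continuous w ->
  regular_distr (glue f g) (derive1 phi) =
    - regular_distr (glue u w) phi + (g 0 - f 0) * phi 0.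
Proof.
move=> tphi df dg cu cw.
have cf := is_derive1_continuous df.
have cg := is_derive1_continuous dg.
have dphi x := test_function_is_derive x tphi.
have cphi := is_derive1_continuous dphi.
have cphi' := test_function_continuous_derive tphi.
have [M M_gt0 phi0] := test_function_support tphi.
have phi'0 x : M < `|x| -> derive1 phi x = 0.
  move=> Mx; rewrite derive1E (near_eq_derive (g := cst 0)) ?derive_cst//.
  near=> y; apply: phi0; apply: ltW; near: y.
  by apply: (cvgr_gt `|x|) => //; apply: cvg_norm.
(* With the two integrals merged, the integrand is on each half-line the exact derivative of a
   product with [phi]. *)
suff : \int[mu]_x (glue f g x * derive1 phi x + glue u w x * phi x) =
    (g 0 - f 0) * phi 0.
  rewrite RintegralD//; last 2 first.
  - exact: glueM_integrable M_gt0 _ _ _ phi'0.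
  - exact: regular_distr_glue_integrable.
  by rewrite /regular_distr; lra.
have dM (a b : R -> R) : (forall x, is_derive x 1 a (b x)) -> forall x,
    is_derive x 1 (fun x => a x * phi x) (a x * derive1 phi x + b x * phi x).
  move=> dab x; apply: is_derive_eq (is_deriveM (dab x) (dphi x)) _.
  by rewrite /GRing.scale/= (mulrC (phi x)).
have E : (fun x => glue f g x * derive1 phi x + glue u w x * phi x) =
    glue (fun x => f x * derive1 phi x + u x * phi x)
           (fun x => g x * derive1 phi x + w x * phi x).
  by apply/funext => x; rewrite /glue; case: ifP.
have cD (a b : R -> R) : continuous a -> continuous b ->
   continuous (fun x => a x * derive1 phi x + b x * phi x).
  move=> ca cb x; apply: cvgD; apply: cvgM;
    [exact: ca|exact: cphi'|exact: cb|exact: cphi].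
rewrite E (integral_glueE M_gt0 _ _ _).2; first last.
- by move=> x Mx; rewrite -E phi'0// phi0 ?ltW// !mulr0 addr0.
- exact: cD.
- exact: cD.
rewrite (@Rintegral_continuous_FTC2 (fun x => g x * phi x)) ?oppr_lt0//;
  last exact: cD.
rewrite (@Rintegral_continuous_FTC2 (fun x => f x * phi x))//;
  last exact: cD.
rewrite (phi0 M) ?(phi0 (- M)) ?normrN ?gtr0_norm//.
lra.
Unshelve. all: by end_near. Qed.

Lemma is_derive_compN f (x df : R) :
  is_derive (- x) 1 f df -> is_derive x 1 (fun y => f (- y)) (- df).
Proof.
move=> dfx; apply: is_derive_eq (is_derive1_comp dfx (is_deriveNid x 1)) _.
by rewrite mulrN1.
Qed.

Lemma continuous_compN f : continuous f -> continuous (fun x => f (- x)).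
Proof. by move=> cf x; apply: continuous_comp; [exact: opp_continuous|exact: cf]. Qed.

Lemma glue_even f : (fun x => f `|x|) = glue f (fun x => f (- x)).
Proof.
apply/funext => x; rewrite /glue; case: ltP => x0; first by rewrite ltr0_norm.
by rewrite ger0_norm.
Qed.

End glue.

(* [p], [q], [g], [h] are the profiles on the half-line [x > 0] of [phat],
   [D^alpha phat], its weak derivative and the flux [D^(1 - alpha) v]; the jump
   of the flux at 0 produces the delta. *)
Lemma even_laplace_CV_solution (R : realType) (tau B alpha lambda s : R)
    (p q g h : R -> R) :
  continuous p -> continuous g ->
  (forall x, (B * expR (lambda * x)) `^ alpha * p x = q x) ->
  (forall x : R, is_derive x 1 q (g x)) ->
  (forall x, (B * expR (lambda * x)) `^ (1 - alpha) * g x = h x) ->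
  (forall x : R, is_derive x 1 h ((tau * s ^+ 2 + s) * p x)) ->
  2 * h 0 = - (tau * s + 1) ->
  p x @[x --> +oo] --> 0 ->
  laplace_CV_solution tau B alpha lambda s (fun x => p `|x|).
Proof.
move=> cp cg pq dq gh dh h0 py.
have cq := is_derive1_continuous dq.
have ch := is_derive1_continuous dh.
have cpN := continuous_compN cp.
split.
- by rewrite glue_even; exact: glue_locally_integrable.
(* The derivative of an even function is odd. No delta appears at this stage, because both branches
   of the even function equal [q 0] at 0. *)
- exists (glue g (fun x => - g (- x))); split.
    have -> : (fun x => diffusivity B lambda x `^ alpha * p `|x|) =
        glue q (fun x => q (- x)).
      by rewrite -glue_even; apply/funext => x; rewrite /diffusivity pq.
    have cgN : continuous (fun x => - g (- x)).
      by move=> x; apply: cvgN; exact: continuous_compN.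
    split.
    + by apply: glue_locally_integrable => //; exact: continuous_compN.
    + exact: glue_locally_integrable.
    + move=> phi tphi; rewrite /derive_distr.
      have dqN (x : R) : is_derive x 1 (fun x => q (- x)) (- g (- x)).
        exact: is_derive_compN.
      rewrite (regular_distr_glue tphi dq dqN cg cgN).
      by rewrite oppr0 subrr mul0r addr0 opprK.
  move=> phi tphi; rewrite /derive_distr.
  have -> : (fun x => diffusivity B lambda x `^ (1 - alpha) *
       glue g (fun x => - g (- x)) x) = glue h (fun x => - h (- x)).
    apply/funext => x; rewrite /glue /diffusivity; case: ltP => x0.
      by rewrite ltr0_norm// -gh mulrN.
    by rewrite ger0_norm// -gh.
  have cw : continuous (fun x => (tau * s ^+ 2 + s) * p x).
    by move=> x; apply: cvgMr; exact: cp.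
  have dhN (x : R) : is_derive x 1 (fun x => - h (- x)) ((tau * s ^+ 2 + s) * p (- x)).
    by have := is_deriveN (is_derive_compN (dh (- x))); rewrite opprK.
  rewrite (regular_distr_glue tphi dh dhN cw (continuous_compN cw)).
  have -> : regular_distr (glue (fun x => (tau * s ^+ 2 + s) * p x)
      (fun x => (tau * s ^+ 2 + s) * p (- x))) phi =
      (tau * s ^+ 2 + s) * regular_distr (fun x => p `|x|) phi.
    rewrite /regular_distr -RintegralZl//; last first.
      by have := regular_distr_glue_integrable tphi cp cpN; rewrite -glue_even.
    apply: eq_Rintegral => x _; have -> : p `|x| = glue p (fun x => p (- x)) x.
      by rewrite -glue_even.
    by rewrite /glue; case: ifP => _; rewrite mulrA.
  (* The boundary coefficient is [- h 0 - h 0], that is [tau * s + 1]; the outer [derive_distr]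
     reverses its sign. *)
  rewrite oppr0 /delta_distr; set J := regular_distr _ _; nra.
- apply: cvg_trans py; apply: near_eq_cvg.
  by near=> x; rewrite ger0_norm.
- apply/cvgNy_compNP; apply: cvg_trans py; apply: near_eq_cvg.
  by near=> x; rewrite /= normrN ger0_norm.
Unshelve. all: by end_near. Qed.

(** * The reciprocal Gamma function *)

(** Bernoulli's inequality for exponents in [0, 1]. It yields both the lower bound and the
    monotonicity of Gauss's sequence. *)
Lemma bernoulli_powR (R : realType) (x t : R) :
  0 <= x <= 1 -> -1 < t -> (1 + t) `^ x <= 1 + x * t.
Proof.
move=> /andP[x0 x1] t1; have t1_gt0 : 0 < 1 + t by lra.
have c0 : 0 < expR (x * ln (1 + t)) by exact: expR_gt0.
rewrite /powR gt_eqF//.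
set C := x * ln (1 + t) in c0 *.
(* convexity of [expR] through its tangent line at [C] *)
have h1 := expR_ge1Dx (ln (1 + t) - C).
have h2 := expR_ge1Dx (- C).
rewrite expRD lnK// in h1.
(* The tangent inequalities are averaged with weights [x] and [1 - x]; since [C = x * ln (1 + t)],
   the left-hand side is exactly 1. *)
have h3 : x * (1 + (ln (1 + t) - C)) + (1 - x) * (1 + - C) <=
    x * ((1 + t) * expR (- C)) + (1 - x) * expR (- C).
  by rewrite lerD// ler_wpM2l// subr_ge0.
have {}h3 : 1 <= (1 + x * t) * expR (- C) by move: h3; rewrite /C; lra.
by move: h3; rewrite expRN ler_pdivlMr// mul1r.
Qed.

Section rgamma.
Context {R : realType}.
Implicit Types x y z : R.

Let gauss x (n : nat) : R :=
  (\prod_(k < n.+1) (x + k%:R)) / (n`!%:R * n%:R `^ x).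

Let prodD_gt0 x n : 0 < x -> 0 < \prod_(k < n) (x + k%:R).
Proof. by move=> x0; apply: prodr_gt0 => k _; rewrite ltr_wpDr. Qed.

(** Taking the power of [n.+1] instead of [n] makes the case [n = 0] an equality; the inductive step
    is Bernoulli at [t = 1 / (n + 1)]. *)
Let prodD_ge x n : 0 < x <= 1 ->
  x * (n`!%:R * n.+1%:R `^ x) <= \prod_(k < n.+1) (x + k%:R).
Proof.
move=> /andP[x0 x1]; elim: n => [|n IHn].
  by rewrite big_ord_recr big_ord0/= fact0 powR1 !mulr1 mul1r addr0.
rewrite big_ord_recr/=.
have N0 : 0 < n.+1%:R :> R by rewrite ltr0n.
have xn0 : 0 <= x + n.+1%:R by rewrite addr_ge0// ltW.
apply: le_trans (ler_wpM2r xn0 IHn).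
have -> : n.+2%:R = n.+1%:R * (1 + n.+1%:R^-1) :> R.
  by rewrite mulrDr mulr1 divff ?gt_eqF// natr1.
rewrite powRM// ?addr_ge0 ?invr_ge0// factS natrM.
have B := @bernoulli_powR _ x n.+1%:R^-1.
have {B} B : (1 + n.+1%:R^-1) `^ x <= 1 + x * n.+1%:R^-1.
  by apply: B; rewrite ?(ltW x0)// (lt_le_trans (ltrN10 _))// invr_ge0.
have -> : x * (n.+1%:R * n`!%:R * (n.+1%:R `^ x * (1 + n.+1%:R^-1) `^ x)) =
   (x * (n`!%:R * n.+1%:R `^ x)) * (n.+1%:R * (1 + n.+1%:R^-1) `^ x) by ring.
apply: ler_wpM2l; first by rewrite !mulr_ge0 ?powR_ge0// ltW.
apply: le_trans (ler_wpM2l (ltW N0) B) _.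
by rewrite mulrDr mulr1 mulrCA divff ?gt_eqF// mulr1 addrC.
Qed.

(** Index 0 is excluded: there the power of 0 vanishes, and division by zero gives [gauss x 0] the
    default value 0. *)
Let gauss_ge x n : 0 < x <= 1 -> (0 < n)%N -> x <= gauss x n.
Proof.
move=> x01 n0; have /andP[x0 x1] := x01.
have d0 : 0 < n`!%:R * n%:R `^ x :> R.
  by rewrite mulr_gt0 ?powR_gt0 ?ltr0n// fact_gt0.
rewrite ler_pdivlMr//; apply: le_trans (prodD_ge n x01).
apply: ler_wpM2l; first exact: ltW.
apply: ler_wpM2l; first exact: ler0n.
by apply: ge0_ler_powR; rewrite ?nnegrE ?ler0n ?ler_nat// ltW.
Qed.

(** With [N = n + 2], the quotient of the two terms is [1 + x / N] times the [x]-th power of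
    [1 - 1 / N]. By Bernoulli it is at most [(1 + x / N) * (1 - x / N) <= 1]. *)
Let gauss_nonincreasing x n : 0 < x <= 1 -> gauss x n.+2 <= gauss x n.+1.
Proof.
move=> x01; have /andP[x0 x1] := x01; set N : R := n.+2%:R.
have N0 : 0 < N by rewrite ltr0n.
have M0 : 0 < n.+1%:R :> R by rewrite ltr0n.
have M0x := powR_gt0 x M0.
have F0 : 0 < n.+1`!%:R :> R by rewrite ltr0n fact_gt0.
rewrite ler_pdivrMr; last first.
  by rewrite mulr_gt0 ?powR_gt0 ?ltr0n// fact_gt0.
rewrite big_ord_recr/= factS natrM -/N.
have -> : gauss x n.+1 * (N * n.+1`!%:R * N `^ x) =
   (\prod_(i < n.+2) (x + i%:R)) * (N * N `^ x / n.+1%:R `^ x).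
  by rewrite /gauss; field; rewrite !gt_eqF.
apply: ler_wpM2l; first by rewrite ltW// prodD_gt0.
rewrite ler_pdivlMr//.
have -> : n.+1%:R = N * (1 + - N^-1) :> R.
  by rewrite mulrBr mulr1 divff ?gt_eqF// /N -[n.+2%:R]natr1 addrK.
have Ni : 0 < N^-1 by rewrite invr_gt0.
have Ni1 : N^-1 < 1 by rewrite invf_lt1// ltr1n.
have Ni2 : 0 <= 1 + - N^-1 by rewrite subr_ge0 ltW.
rewrite powRM ?(ltW N0)//.
have B : (1 + - N^-1) `^ x <= 1 + x * - N^-1.
  by apply: bernoulli_powR; [rewrite (ltW x0)|rewrite ltrN2].
rewrite mulrCA mulrC ler_pM2r ?powR_gt0//.
have xN0 : 0 <= x + N by rewrite addr_ge0// ltW.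
apply: le_trans (ler_wpM2l xN0 B) _.
have -> : (x + N) * (1 + x * - N^-1) = N - x * x * N^-1.
  by field; rewrite gt_eqF.
by rewrite lerBlDr lerDl !mulr_ge0// ltW.
Qed.

Let cvg_gauss01 x : 0 < x <= 1 -> cvgn (gauss x) /\ 0 < limn (gauss x).
Proof.
move=> x01; have /andP[x0 _] := x01.
have c : cvgn (fun n => gauss x n.+1).
  apply: nonincreasing_is_cvgn.
    by apply/nonincreasing_seqP => n; exact: gauss_nonincreasing.
  by exists x => _ [n _ <-]; exact: gauss_ge.
have cl : gauss x @ \oo --> limn (fun n => gauss x n.+1).
  by rewrite -cvg_shiftS; exact: c.
split; first by apply/cvg_ex; eexists; exact: cl.
rewrite (cvg_lim _ cl)//; apply: lt_le_trans x0 _.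
by apply: limr_ge => //; apply: nearW => n; exact: gauss_ge.
Qed.

(** The functional equation of Gamma already holds for the terms of the sequence, up to the factor
    [1 + (x + 1) / n], which tends to 1. *)
Let cvg_gaussS x (l : R) : 0 < x ->
  gauss x @ \oo --> l -> gauss (x + 1) @ \oo --> l / x.
Proof.
move=> x0 cx.
rewrite -(cvg_shiftS (gauss (x + 1))).
have -> : (fun n => gauss (x + 1) n.+1) =
    (fun n => gauss x n.+1 / x * (1 + (x + 1) * (n.+1%:R)^-1)).
  apply/funext => n; rewrite /gauss.
  have M0 : 0 < n.+1%:R :> R by rewrite ltr0n.
  have F0 : 0 < n.+1`!%:R :> R by rewrite ltr0n fact_gt0.
  have M0x := powR_gt0 x M0.
  have -> : n.+1%:R `^ (x + 1) = n.+1%:R `^ x * n.+1%:R.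
    by rewrite powRD ?powRr1 ?(ltW M0)// (gt_eqF M0) implybT.
  rewrite big_ord_recr/= [in RHS]big_ord_recl/= addr0.
  have -> : \prod_(i < n.+1) (x + 1 + i%:R) =
      \prod_(i < n.+1) (x + (lift ord0 i)%:R).
    by apply: eq_bigr => i _; rewrite lift0 -natr1 -addrA [1 + _]addrC.
  by field; rewrite !gt_eqF.
have -> : l / x = l / x * (1 + (x + 1) * 0) by rewrite mulr0 addr0 mulr1.
apply: cvgM.
  by apply: cvgMl; rewrite (cvg_shiftS (gauss x)).
apply: cvgD; first exact: cvg_cst.
by apply: cvgMr; exact: cvg_harmonic.
Qed.

(** The result on (0, 1] is carried to all positive reals by unit shifts, by induction on an integer
    bound for [x]. *)
Let cvg_gauss x : 0 < x -> cvgn (gauss x) /\ 0 < limn (gauss x).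
Proof.
suff H m : forall x, 0 < x <= m.+1%:R -> cvgn (gauss x) /\ 0 < limn (gauss x).
  by move=> x0; apply: (H (Num.truncn x)); rewrite x0/= ltW// truncnS_gt.
elim: m => [|m IHm] y /andP[y0 ym]; first by apply: cvg_gauss01; rewrite y0.
have [ym'|ym'] := leP y m.+1%:R; first by apply: IHm; rewrite y0.
have [|c l0] := IHm (y - 1).
  rewrite subr_gt0 lerBlDr natr1 ym andbT.
  by apply: le_lt_trans ym'; rewrite ler1n.
have y1 : 0 < y - 1 by rewrite subr_gt0 (le_lt_trans _ ym')// ler1n.
have := cvg_gaussS y1 c; rewrite subrK => cy.
by split; [apply/cvg_ex; eexists; exact: cy|rewrite (cvg_lim _ cy)// divr_gt0].
Qed.

Lemma rgamma_gt0 x : 0 < x -> 0 < rgamma x.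
Proof. by move=> /cvg_gauss[]. Qed.

Lemma rgamma0 : rgamma (0 : R) = 0.
Proof.
rewrite /rgamma [X in limn X](_ : _ = fun=> 0); first exact: lim_cst.
by apply/funext => n; rewrite big_ord_recl/= addr0 !mul0r.
Qed.

Lemma rgamma_rec x : 0 <= x -> rgamma x = x * rgamma (x + 1).
Proof.
rewrite le_eqVlt => /predU1P[<-|x0]; first by rewrite rgamma0 mul0r.
have [cx _] := cvg_gauss x0; have := cvg_gaussS x0 cx.
move=> /(cvg_lim (@Rhausdorff R)) E.
by rewrite {2}/rgamma E mulrCA divff ?mulr1// gt_eqF.
Qed.

Lemma rgamma_ge0 x : 0 <= x -> 0 <= rgamma x.
Proof.
by rewrite le_eqVlt => /predU1P[<-|/rgamma_gt0/ltW//]; rewrite rgamma0.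
Qed.

(** From [x + 1] on, [rgamma] does not increase under unit shifts, because the factor in
    [rgamma_rec] is at least 1; the summand [rgamma x] covers [m = 0]. The bound is uniform in
    [m]. *)
Lemma rgamma_natD_le x m : 0 <= x -> rgamma (m%:R + x) <= rgamma x + rgamma (x + 1).
Proof.
move=> x0; case: m => [|m].
  by rewrite add0r lerDl rgamma_ge0// addr_ge0.
apply: (@le_trans _ _ (rgamma (x + 1))); last by rewrite lerDr rgamma_ge0.
elim: m => [|m IHm]; first by rewrite addrC.
apply: le_trans IHm; have m0 : 0 <= m.+1%:R + x by rewrite addr_ge0.
rewrite (rgamma_rec m0) -natr1 addrAC ler_peMl//; last first.
  by rewrite -natr1 addrAC lerDr addr_ge0.
by rewrite rgamma_ge0// !addr_ge0.
Qed.

End rgamma.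

(** * The functions [I_nu] as power series *)

Definition besselI_coeff (R : realType) (b : R) (m : nat) : R :=
  rgamma (m%:R + b) / m`!%:R.

(** The regularized hypergeometric function 0F1(; b; y) / Gamma(b), entire in [y]: with
    [y = (z / 2)^2] it is I_(b - 1)(z) stripped of its power of [z / 2]. *)
Definition besselI_series (R : realType) (b y : R) : R :=
  limn (pseries (besselI_coeff b) y).

Section besselI.
Context {R : realType}.
Implicit Types b y z nu : R.

(** The uniform bound on [rgamma] makes a multiple of the exponential series at [|y|] a majorant. *)
Lemma is_cvg_besselI_series b y : 0 <= b -> cvgn (pseries (besselI_coeff b) y).
Proof.
move=> b0; apply: normed_cvg.
set K := rgamma b + rgamma (b + 1).
have K0 : 0 <= K by rewrite addr_ge0 ?rgamma_ge0// addr_ge0.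
apply: (@series_le_cvg _ _ (K *: exp_coeff `|y|)) => [n|n|n|].
- exact: normr_ge0.
- by apply: mulr_ge0 => //; rewrite /exp_coeff/= divr_ge0// exprn_ge0.
- rewrite /= normrM normrX /besselI_coeff ger0_norm; last first.
    by rewrite divr_ge0// rgamma_ge0// addr_ge0.
  rewrite -mulrA [_^-1 * _]mulrC; apply: ler_wpM2r.
    by rewrite divr_ge0// exprn_ge0.
  exact: rgamma_natD_le.
- exact/is_cvg_seriesZ/is_cvg_series_exp_coeff.
Qed.

Lemma besselI_coeff_diffs b :
  pseries_diffs (besselI_coeff b) = besselI_coeff (b + 1).
Proof.
apply/funext => m; rewrite /pseries_diffs /besselI_coeff factS natrM.
rewrite (_ : m.+1%:R + b = m%:R + (b + 1)); last by rewrite -natr1; ring.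
by rewrite mulrCA invfM mulVKf.
Qed.

(** The series form of [(z^(- nu) I_nu)' = z^(- nu) I_(nu + 1)]: differentiating term by term shifts
    [b] by one. *)
Lemma is_derive_besselI_series b y : 0 <= b ->
  is_derive y 1 (besselI_series b) (besselI_series (b + 1) y).
Proof.
move=> b0; rewrite {2}/besselI_series -besselI_coeff_diffs.
apply: (@pseries_snd_diffs _ _ (`|y| + 1)).
- exact: is_cvg_besselI_series.
- by rewrite besselI_coeff_diffs; apply: is_cvg_besselI_series; rewrite addr_ge0.
- rewrite !besselI_coeff_diffs; apply: is_cvg_besselI_series.
  by rewrite !addr_ge0.
- by rewrite [ltRHS]ger0_norm ?addr_ge0// ltrDl.
Qed.

(* The series form of [(z^nu I_nu)' = z^nu I_(nu - 1)]. *)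
Lemma besselI_series_rec b y : 0 <= b ->
  besselI_series b y =
    b * besselI_series (b + 1) y + y * besselI_series (b + 1 + 1) y.
Proof.
move=> b0; have b1 : 0 <= b + 1 by rewrite addr_ge0.
apply/cvg_lim => //.
have cb2 := @is_cvg_besselI_series (b + 1 + 1) y (addr_ge0 b1 ler01).
have c2 : cvgn (pseries (pseries_diffs (besselI_coeff (b + 1))) y).
  by rewrite besselI_coeff_diffs.
have := pseries_diffs_equiv c2; rewrite besselI_coeff_diffs => {}c2.
have c1 := @is_cvg_besselI_series (b + 1) y b1.
(* In [rgamma (m + b) = (m + b) * rgamma (m + b + 1)] the factor [m + b] is split: [b] gives the
   first series, and [m] gives [y] times the formal derivative of the series for [b + 1]. *)
have -> : pseries (besselI_coeff b) y = (fun n =>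
    b * pseries (besselI_coeff (b + 1)) y n +
    y * series (fun i => i%:R * besselI_coeff (b + 1) i * y ^+ i.-1) n).
  apply/funext => n; rewrite /pseries /series/= !mulr_sumr -big_split/=.
  apply: eq_bigr => -[|m] _.
    rewrite /besselI_coeff !expr0 fact0 add0r rgamma_rec// add0r.
    by rewrite !mul0r mulr0 addr0 !mulr1 !divr1.
  rewrite /besselI_coeff rgamma_rec ?addr_ge0// exprS/=.
  by rewrite (_ : m.+1%:R + b + 1 = m.+1%:R + (b + 1)); ring.
apply: cvgD; apply: cvgMr; [exact: c1|exact: c2].
Qed.

Lemma besselI_series_gt0 b y : 0 < b -> 0 <= y -> 0 < besselI_series b y.
Proof.
move=> b0 y0; rewrite /besselI_series.
have nd : {homo pseries (besselI_coeff b) y : n m / (n <= m)%N >-> n <= m}.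
  apply/nondecreasing_seqP => n; rewrite /pseries /series/= big_nat_recr//=.
  rewrite lerDl mulr_ge0 ?exprn_ge0// divr_ge0// rgamma_ge0// addr_ge0//.
  exact: ltW.
have := nondecreasing_cvgn_le nd (@is_cvg_besselI_series _ _ (ltW b0)) 1%N.
apply: lt_le_trans.
rewrite /pseries /series/= big_nat1 expr0 mulr1 /besselI_coeff add0r fact0 divr1.
exact: rgamma_gt0.
Qed.

(** The range starts at -1 because the order [alpha - 1] reaches -1 when [alpha = 0]. *)
Lemma besselIE nu z : -1 <= nu -> 0 < z ->
  besselI nu z = (z / 2) `^ nu * besselI_series (nu + 1) ((z / 2) ^+ 2).
Proof.
move=> nu1 z0; have z2 : 0 < z / 2 by rewrite divr_gt0.
have nu0 : 0 <= nu + 1 by lra.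
rewrite /besselI /besselI_series.
rewrite -[RHS](lim_seriesZ _ (@is_cvg_besselI_series _ _ nu0)).
congr (limn (series _)); apply/funext => m.
rewrite powRD ?(gt_eqF z2) ?implybT// -natrM powR_mulrn ?(ltW z2)// exprM.
by rewrite /besselI_coeff /GRing.scale/= addrA -[RHS]/(_ * _); ring.
Qed.

End besselI.

(** * The functions [K_nu] *)

Definition sinh (R : realType) (t : R) : R := (expR t - expR (- t)) / 2.

(** * Hyperbolic functions and the decay of [expR (- z * cosh t)] *)

Section hyperbolic.
Context {R : realType}.
Implicit Types t u z : R.

Lemma expR_mulN t : expR t * expR (- t) = 1 :> R.
Proof. by rewrite -expRD subrr expR0. Qed.

Lemma coshN t : cosh (- t) = cosh t :> R.
Proof. by rewrite /cosh opprK addrC. Qed.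

Lemma cosh_gt0 t : 0 < cosh t :> R.
Proof. by rewrite /cosh divr_gt0// addr_gt0// expR_gt0. Qed.

Lemma cosh_geexpR t : expR t / 2 <= cosh t :> R.
Proof. by rewrite /cosh ler_pM2r// lerDl expR_ge0. Qed.

Lemma ler_cosh u t : 0 <= u -> u <= t -> cosh u <= cosh t :> R.
Proof.
move=> u0 ut; rewrite /cosh ler_pM2r//.
have Et := expR_mulN t; have Eu := expR_mulN u.
have h1 : 1 <= expR u by rewrite -expR0 ler_expR.
have h2 : expR u <= expR t by rewrite ler_expR.
have ht := expR_gt0 (- t); have hu := expR_gt0 (- u).
have h3 : expR (- t) <= expR (- u) by rewrite ler_expR lerN2.
have h4 : expR (- u) <= 1 by rewrite -expR0 ler_expR oppr_le0.
(* This product equals [2 * (cosh t - cosh u)]. *)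
have h : 0 <= (expR t - expR u) * (1 - expR (- t) * expR (- u)).
  apply: mulr_ge0; first by rewrite subr_ge0.
  by rewrite subr_ge0 mulr_ile1 ?(ltW ht) ?(ltW hu) ?(le_trans h3 h4).
move: h.
rewrite (_ : _ * _ = expR t - expR u - (expR t * expR (- t)) * expR (- u) +
   (expR u * expR (- u)) * expR (- t)); last by ring.
rewrite Et Eu; lra.
Qed.

Lemma cosh0 : cosh 0 = 1 :> R.
Proof. by rewrite /cosh oppr0 expR0 -mulr2n -(mulr_natr 1) mul1r divff. Qed.

Lemma sinh0 : sinh 0 = 0 :> R.
Proof. by rewrite /sinh oppr0 subrr mul0r. Qed.

Lemma cosh_ge1 t : 0 <= t -> 1 <= cosh t :> R.
Proof. by move=> t0; rewrite -cosh0 ler_cosh. Qed.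

Lemma sinh_ge0 t : 0 <= t -> 0 <= sinh t :> R.
Proof. by move=> t0; rewrite divr_ge0// subr_ge0 ler_expR; lra. Qed.

Lemma sinh_le_cosh t : sinh t <= cosh t :> R.
Proof. by rewrite /sinh /cosh ler_pM2r// lerD2l; have := expR_gt0 (- t); lra. Qed.

Lemma coshB t u : cosh (t - u) = cosh t * cosh u - sinh t * sinh u :> R.
Proof.
rewrite /cosh /sinh opprB !expRD; lra.
Qed.

Lemma is_derive_expRZ (a t : R) :
  is_derive t 1 (fun t => expR (a * t)) (a * expR (a * t)).
Proof.
have d : is_derive t 1 (fun t => a * t) a.
  by apply: is_derive_eq (is_deriveZ a (is_derive_id t 1)) _; rewrite /GRing.scale/= mulr1.
apply: is_derive_eq (is_derive1_comp (is_derive_expR (a * t)) d) _.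
by rewrite mulrC.
Qed.

Lemma is_derive_coshZ (a t : R) :
  is_derive t 1 (fun t => cosh (a * t)) (a * sinh (a * t)).
Proof.
have -> : (fun t => cosh (a * t)) =
    (fun t => 2^-1 * (expR (a * t) + expR ((- a) * t))).
  by apply/funext => x; rewrite /cosh mulrC mulNr.
have d := is_deriveZ 2^-1 (is_deriveD (is_derive_expRZ a t) (is_derive_expRZ (- a) t)).
apply: is_derive_eq d _.
by rewrite /GRing.scale/= /sinh !mulNr; field.
Qed.

Lemma is_derive_sinhZ (a t : R) :
  is_derive t 1 (fun t => sinh (a * t)) (a * cosh (a * t)).
Proof.
have -> : (fun t => sinh (a * t)) =
    (fun t => 2^-1 * (expR (a * t) - expR ((- a) * t))).
  by apply/funext => x; rewrite /sinh mulrC mulNr.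
have d := is_deriveZ 2^-1 (is_deriveB (is_derive_expRZ a t) (is_derive_expRZ (- a) t)).
apply: is_derive_eq d _.
by rewrite /GRing.scale/= /cosh !mulNr; field.
Qed.

Lemma is_derive_cosh t : is_derive t 1 (@cosh R) (sinh t).
Proof.
have := is_derive_coshZ 1 t; rewrite !mul1r.
by under [X in is_derive _ _ X _]eq_fun do rewrite mul1r.
Qed.

Lemma is_derive_sinh t : is_derive t 1 (@sinh R) (cosh t).
Proof.
have := is_derive_sinhZ 1 t; rewrite !mul1r.
by under [X in is_derive _ _ X _]eq_fun do rewrite mul1r.
Qed.

Lemma is_derive_expR_cosh z t :
  is_derive t 1 (fun t => expR (z * cosh t)) (z * sinh t * expR (z * cosh t)).
Proof.
have d : is_derive t 1 (fun t => z * cosh t) (z * sinh t).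
  by apply: is_derive_eq (is_deriveZ z (is_derive_cosh t)) _.
apply: is_derive_eq (@is_derive1_comp _ expR _ _ _ _ (is_derive_expR _) d) _.
by rewrite mulrC.
Qed.

(* [expR x >= x ^ 4 / 4!] with [x = z cosh t]. *)
Lemma expR_cosh_le z t : 0 < z -> 0 <= t ->
  expR (- z * cosh t) * cosh t ^+ 2 <= 48 / z ^+ 4 * expR (- t).
Proof.
move=> z0 t0; have c1 := cosh_ge1 t0; have c0 := cosh_gt0 t.
set c := cosh t in c1 c0 *.
have zc0 : 0 < z * c by rewrite mulr_gt0.
have h1 : (z * c) ^+ 4 / 24 <= expR (z * c).
  have := @expR_ge1Dxn _ (z * c) 3 (ltW zc0).
  by apply: le_trans; rewrite ler_wpDl.
rewrite mulNr [expR (- (z * c))]expRN.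
have h2 : (expR (z * c))^-1 <= 24 / (z * c) ^+ 4.
  rewrite -[leRHS]invrK lef_pV2 ?posrE ?invr_gt0 ?expR_gt0//; last first.
    by rewrite divr_gt0// exprn_gt0.
  by rewrite invf_div.
(* Of the two factors [c^-1] that remain below, one supplies the decay and doubles 24 into 48; the
   other is bounded by 1. *)
have h3 : c^-1 <= 2 * expR (- t).
  rewrite expRN -invf_div lef_pV2 ?posrE ?c0 ?divr_gt0 ?expR_gt0//.
  exact: cosh_geexpR.
apply: (@le_trans _ _ (24 / (z * c) ^+ 4 * c ^+ 2)).
  by apply: ler_wpM2r; rewrite ?exprn_ge0// ltW.
have -> : 24 / (z * c) ^+ 4 * c ^+ 2 = 24 / z ^+ 4 * (c^-1 * c^-1).
  by field; rewrite !gt_eqF.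
have -> : 48 / z ^+ 4 * expR (- t) = 24 / z ^+ 4 * (2 * expR (- t)).
  by field; rewrite !gt_eqF.
apply: ler_wpM2l; first by rewrite divr_ge0// exprn_ge0// ltW.
apply: le_trans h3; rewrite ler_piMl ?invr_ge0 ?(ltW c0)//.
by rewrite invf_le1.
Qed.

End hyperbolic.

(** * Half-line integrals dominated by a multiple of [expR (- t)] *)

Section exponential_domination.
Context {R : realType}.
Implicit Types (f F : R -> R) (C l : R).
Local Notation mu := (@lebesgue_measure R).

Lemma integral_FTC2y_ge0 f F l : (forall t, 0 <= t -> 0 <= f t) ->
  continuous f -> (forall t : R, is_derive t 1 F (f t)) ->
  F t @[t --> +oo] --> l ->
  (\int[mu]_(t in `[0%R, +oo[) (f t)%:E)%E = (l - F 0)%:E.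
Proof.
move=> f0 cf dF Fl; rewrite (@ge0_continuous_FTC2y _ f F 0 l)//.
- exact: continuous_subspaceT.
- exact/cvg_at_right_filter/(is_derive1_continuous dF).
- by move=> x _; rewrite derive1E derive_val.
Qed.

Lemma is_derive_expRN (t : R) :
  is_derive t 1 (fun t => - expR (- t)) (expR (- t)).
Proof.
have := is_deriveN (is_derive_expRZ (- 1) t).
by rewrite !mulN1r opprK; under [X in is_derive _ _ X _]eq_fun do rewrite mulN1r.
Qed.

Lemma continuous_expRN : continuous (fun t : R => expR (- t)).
Proof. by apply: continuous_compN; exact: continuous_expR. Qed.

Lemma integral_expRN : (\int[mu]_(t in `[0%R, +oo[) (expR (- t))%:E)%E = 1%:E.
Proof.
rewrite (integral_FTC2y_ge0 _ continuous_expRN is_derive_expRN (l := 0)).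
- by rewrite oppr0 expR0 opprK add0r.
- by move=> t _; exact: expR_ge0.
- by rewrite -oppr0; apply: cvgN; exact: cvgr_expR.
Qed.

Lemma integrable_expRN : mu.-integrable `[0, +oo[ (EFin \o (fun t => expR (- t))).
Proof.
apply/integrableP; split.
  apply/measurable_EFinP; apply: measurable_funTS; apply: continuous_measurable_fun.
  exact: continuous_expRN.
rewrite (_ : integral _ _ _ = 1%:E) ?ltry// -integral_expRN.
by apply: eq_integral => t _; rewrite /= ger0_norm ?expR_ge0.
Qed.

Lemma integrable_ZexpRN C :
  mu.-integrable `[0, +oo[ (EFin \o (fun t => C * expR (- t))).
Proof.
have := @integrableZl _ _ _ mu _ (measurable_itv _) C _ integrable_expRN.
by apply: eq_integrable => // t _; rewrite /= EFinM.
Qed.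

Lemma Rintegral_ZexpRN C : \int[mu]_(t in `[0, +oo[) (C * expR (- t)) = C.
Proof.
rewrite RintegralZl//; last exact: integrable_expRN.
by rewrite /Rintegral integral_expRN mulr1.
Qed.

Lemma expRN_dominated_integrable f C : continuous f ->
  (forall t, 0 <= t -> `|f t| <= C * expR (- t)) ->
  mu.-integrable `[0, +oo[ (EFin \o f).
Proof.
move=> cf fC; apply: le_integrable (integrable_ZexpRN C) => //.
  by apply/measurable_EFinP; apply: measurable_funTS; apply: continuous_measurable_fun.
move=> t /=; rewrite in_itv/= andbT => t0.
by rewrite lee_fin; apply: le_trans (fC _ t0) (ler_norm _).
Qed.

(* Adding the majorant reduces to a nonnegative integrand. *)
Lemma Rintegral_FTC2y_dominated f F C l : continuous f ->
  (forall t, 0 <= t -> `|f t| <= C * expR (- t)) ->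
  (forall t : R, is_derive t 1 F (f t)) ->
  F t @[t --> +oo] --> l ->
  \int[mu]_(t in `[0, +oo[) f t = l - F 0.
Proof.
move=> cf fC dF Fl.
have if1 := expRN_dominated_integrable cf fC.
have ie := integrable_ZexpRN C.
pose g t := f t + C * expR (- t).
pose G t := F t + C * (- expR (- t)).
have dG (t : R) : is_derive t 1 G (g t).
  exact: is_deriveD (dF t) (is_deriveZ C (is_derive_expRN t)).
have cg : continuous g.
  by move=> t; apply: cvgD; [exact: cf|apply: cvgMr; exact: continuous_expRN].
have Gl : G t @[t --> +oo] --> l.
  rewrite -[l]addr0 -(mulr0 C) -[in C * 0]oppr0; apply: cvgD => //.
  by apply: cvgMr; apply: cvgN; exact: cvgr_expR.
have g0 t : 0 <= t -> 0 <= g t.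
  by move=> /fC; rewrite ler_norml /g => /andP[+ _]; lra.
have := integral_FTC2y_ge0 g0 cg dG Gl.
move=> /(congr1 fine)/=; rewrite -/(Rintegral _ _ _) RintegralD//.
rewrite Rintegral_ZexpRN /G oppr0 expR0; lra.
Qed.

End exponential_domination.

(** * Positivity, decay and derivative of K_nu for orders in [0, 1] *)

Section besselK.
Context {R : realType}.
Implicit Types nu z t a : R.
Local Notation mu := (@lebesgue_measure R).

Let k nu z t : R := expR (- z * cosh t) * cosh (nu * t).

Lemma besselKN nu z : besselK (- nu) z = besselK nu z.
Proof. by apply: eq_Rintegral => t _; rewrite [- nu * t]mulNr coshN. Qed.

(** Restricting the order to [0, 1], which contains both [alpha] and [1 - alpha], gives a majorant
    of the integrand free of [nu]. *)
Lemma cosh_mul_le nu t : 0 <= nu <= 1 -> 0 <= t -> cosh (nu * t) <= cosh t.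
Proof.
by move=> /andP[nu0 nu1] t0; apply: ler_cosh; rewrite ?mulr_ge0// ler_piMl.
Qed.

Let continuous_coshZ nu : continuous (fun t => cosh (nu * t)).
Proof. by apply: is_derive1_continuous => t; exact: is_derive_coshZ. Qed.

Let continuous_expR_cosh z : continuous (fun t => expR (z * cosh t)).
Proof. by apply: is_derive1_continuous => t; exact: is_derive_expR_cosh. Qed.

Let continuous_k nu z : continuous (k nu z).
Proof.
by move=> t; apply: cvgM; [exact: continuous_expR_cosh|exact: continuous_coshZ].
Qed.

Let continuous_coshk nu z : continuous (fun t => cosh t * k nu z t).
Proof.
move=> t; apply: cvgM; last exact: continuous_k.
by apply: is_derive1_continuous => u; exact: is_derive_cosh.
Qed.

Let coshk_bound nu z t : 0 <= nu <= 1 -> 0 < z -> 0 <= t ->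
  `|cosh t * k nu z t| <= 48 / z ^+ 4 * expR (- t).
Proof.
move=> nu01 z0 t0; rewrite ger0_norm; last first.
  by rewrite !mulr_ge0 ?expR_ge0 ?(ltW (cosh_gt0 _)).
apply: le_trans (expR_cosh_le z0 t0).
rewrite /k mulrCA expr2; apply: ler_wpM2l; first exact: expR_ge0.
by apply: ler_wpM2l; [exact/ltW/cosh_gt0|exact: cosh_mul_le].
Qed.

Let k_ge0 nu z t : 0 <= k nu z t.
Proof. by rewrite mulr_ge0 ?expR_ge0 ?(ltW (cosh_gt0 _)). Qed.

Let k_bound nu z t : 0 <= nu <= 1 -> 0 < z -> 0 <= t ->
  `|k nu z t| <= 48 / z ^+ 4 * expR (- t).
Proof.
move=> nu01 z0 t0; apply: le_trans (coshk_bound nu01 z0 t0).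
by rewrite [leRHS]normrM ler_peMl// ger0_norm ?cosh_ge1// ltW// cosh_gt0.
Qed.

Let integrable_k nu z : 0 <= nu <= 1 -> 0 < z ->
  mu.-integrable `[0, +oo[ (EFin \o k nu z).
Proof.
move=> nu01 z0; apply: (@expRN_dominated_integrable _ _ (48 / z ^+ 4)) => [|t].
  exact: continuous_k.
exact: k_bound.
Qed.

Let integrable_coshk nu z : 0 <= nu <= 1 -> 0 < z ->
  mu.-integrable `[0, +oo[ (EFin \o (fun t => cosh t * k nu z t)).
Proof.
move=> nu01 z0; apply: (@expRN_dominated_integrable _ _ (48 / z ^+ 4)) => [|t].
  exact: continuous_coshk.
exact: coshk_bound.
Qed.

Lemma besselK_le nu z : 0 <= nu <= 1 -> 0 < z -> besselK nu z <= 48 / z ^+ 4.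
Proof.
move=> nu01 z0; rewrite -[leRHS]Rintegral_ZexpRN; apply: le_Rintegral => //.
- exact: integrable_k.
- exact: integrable_ZexpRN.
- move=> t /=; rewrite in_itv/= andbT => t0.
  by apply: le_trans (k_bound nu01 z0 t0); exact: ler_norm.
Qed.

Lemma besselK_gt0 nu z : 0 <= nu <= 1 -> 0 < z -> 0 < besselK nu z.
Proof.
move=> nu01 z0.
(* As [z sinh t <= expR (z cosh t)], the integrand dominates an exact
   derivative. *)
pose f t := z * sinh t * expR (- (2 * z) * cosh t).
pose F t : R := - 2^-1 * expR (- (2 * z) * cosh t).
have dF (t : R) : is_derive t 1 F (f t).
  apply: is_derive_eq (is_deriveZ (- 2^-1) (is_derive_expR_cosh (- (2 * z)) t)) _.
  by rewrite /GRing.scale/= /f; field.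
have cf : continuous f.
  move=> t; apply: cvgM; last exact: continuous_expR_cosh.
  by apply: cvgMr; apply: (is_derive1_continuous (@is_derive_sinh R)).
have fk (t : R) (t0 : 0 <= t) : 0 <= f t <= k nu z t.
  have s0 := sinh_ge0 t0.
  have -> /= : 0 <= f t.
    by apply: mulr_ge0; [exact: mulr_ge0 (ltW z0) s0|exact: expR_ge0].
  have e0 := expR_gt0 (- z * cosh t).
  (* One of the two exponentials absorbs the factor [z * sinh t], the other remains as a lower bound
     for the integrand. *)
  have -> : f t = z * sinh t * expR (- z * cosh t) * expR (- z * cosh t).
    by rewrite /f -[RHS]mulrA -expRD; congr (_ * expR _); ring.
  have le1 : z * sinh t * expR (- z * cosh t) <= 1.
    rewrite mulNr expRN ler_pdivrMr ?expR_gt0// mul1r.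
    apply: (@le_trans _ _ (z * cosh t)).
      by apply: ler_wpM2l; [exact: ltW|exact: sinh_le_cosh].
    by apply: le_trans (expR_ge1Dx _); rewrite lerDr.
  apply: (@le_trans _ _ (expR (- z * cosh t))); first by rewrite ler_piMl// ltW.
  rewrite /k ler_peMr ?(ltW e0)// cosh_ge1// mulr_ge0//.
  by case/andP: nu01.
have fb : forall t, 0 <= t -> `|f t| <= 48 / z ^+ 4 * expR (- t).
  move=> t t0; have /andP[f0 fkt] := fk t t0.
  rewrite ger0_norm//; apply: le_trans fkt _.
  by apply: le_trans (k_bound nu01 z0 t0); exact: ler_norm.
have F0 : F t @[t --> +oo] --> 0.
  rewrite -[X in _ --> X](mulr0 (- 2^-1)); apply: cvgMr.
  have z20 : 0 < 2 * z by rewrite mulr_gt0.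
  have C1 : (fun t => 48 / (2 * z) ^+ 4 * expR (- t)) @ +oo --> (0 : R).
    by rewrite -(mulr0 (48 / (2 * z) ^+ 4)); apply: cvgMr; exact: cvgr_expR.
  apply: (squeeze_cvgr _ (@cvg_cst _ (0:R) _ _ _) C1); near=> t.
  have t0 : 0 <= t by [].
  rewrite expR_ge0/=; apply: le_trans (expR_cosh_le z20 t0).
  by rewrite ler_peMr ?expR_ge0// exprn_ege1// cosh_ge1.
have := Rintegral_FTC2y_dominated cf fb dF F0.
have -> : 0 - F 0 = 2^-1 * expR (- (2 * z)).
  by rewrite /F cosh0 mulr1 sub0r mulNr opprK.
move=> intf; apply: (@lt_le_trans _ _ (2^-1 * expR (- (2 * z)))).
  by rewrite mulr_gt0 ?expR_gt0.
rewrite -intf; apply: le_Rintegral => //.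
- exact: expRN_dominated_integrable cf fb.
- exact: integrable_k.
- by move=> t /=; rewrite in_itv/= andbT => /fk/andP[].
Unshelve. all: by end_near. Qed.

Let is_derive_k nu z t : is_derive z 1 (k nu ^~ t) (- (cosh t * k nu z t)).
Proof.
have -> : k nu ^~ t = (fun z => cosh (nu * t) * expR (- cosh t * z)).
  by apply/funext => x; rewrite /k mulrC; congr (_ * expR _); ring.
apply: is_derive_eq (is_deriveZ (cosh (nu * t)) (is_derive_expRZ (- cosh t) z)) _.
by rewrite /GRing.scale/= /k (_ : - cosh t * z = - z * cosh t); ring.
Qed.

Lemma is_derive_besselK_int nu z : 0 <= nu <= 1 -> 0 < z ->
  is_derive z 1 (besselK nu)
    (- \int[mu]_(t in `[0, +oo[) (cosh t * k nu z t)).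
Proof.
move=> nu01 z0; have z20 : 0 < z / 2 by rewrite divr_gt0.
(* [expR (- x * cosh t)] decreases in [x], so the bound at [z / 2] dominates the partial derivative
   for every [x] in []z / 2, 2 * z[]. *)
pose G t : R := 48 / (z / 2) ^+ 4 * expR (- t).
have Iz : `]z / 2, 2 * z[%classic z.
  by rewrite /= in_itv/=; apply/andP; split; lra.
have gtI x : `]z / 2, 2 * z[%classic x -> 0 < x.
  by rewrite /= in_itv/= => /andP[+ _]; exact: lt_trans.
have ik x : `]z / 2, 2 * z[%classic x -> mu.-integrable `[0, +oo[ (EFin \o k nu x).
  by move=> /gtI; exact: integrable_k.
have dk x t : `]z / 2, 2 * z[%classic x -> `[0, +oo[%classic t ->
    derivable (k nu ^~ t) x 1.
  by move=> _ _; have := is_derive_k nu x t => -[].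
have G0 t : 0 <= G t.
  by rewrite mulr_ge0 ?expR_ge0// divr_ge0// exprn_ge0// ltW.
have p1 x t : partial1of2 (k nu) x t = - (cosh t * k nu x t).
  by rewrite partial1of2E; have := is_derive_k nu x t => -[].
have ub x t : `]z / 2, 2 * z[%classic x -> `[0, +oo[%classic t ->
    `|partial1of2 (k nu) x t| <= G t.
  rewrite /= !in_itv/= andbT => /andP[xz _] t0.
  rewrite p1 normrN ger0_norm; last by rewrite mulr_ge0// ltW// cosh_gt0.
  apply: le_trans (expR_cosh_le z20 t0).
  rewrite /k mulrCA expr2; apply: ler_pM; rewrite ?expR_ge0//.
  - by rewrite mulr_ge0// ltW// cosh_gt0.
  - by rewrite ler_expR !mulNr lerN2 ler_pM2r ?cosh_gt0// ltW.
  - by apply: ler_wpM2l; [exact/ltW/cosh_gt0|exact: cosh_mul_le].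
have iG := integrable_ZexpRN (48 / (z / 2) ^+ 4).
have d := derivable_under_integral (mu := mu) (measurable_itv _) Iz ik dk G0 iG ub.
have e := differentiation_under_integral (mu := mu) (measurable_itv _) Iz ik dk G0 iG ub.
apply: DeriveDef; first exact: d.
rewrite -derive1E e -[RHS]mulN1r -RintegralZl//; last exact: integrable_coshk.
by apply: eq_Rintegral => t _; rewrite p1 mulN1r.
Qed.

(** Integration by parts with [F t = expR (- z * cosh t) * sinh (nu * t)], which vanishes at 0 and
    at infinity; the product [sinh t * sinh (nu * t)] in its derivative is expanded by [coshB]. The
    integral on the left is [- K_nu'(z)], and the order [1 - nu] stands for [nu - 1], by evenness,
    to stay in [0, 1]. *)
Lemma besselK_rec nu z : 0 <= nu <= 1 -> 0 < z ->
  z * \int[mu]_(t in `[0, +oo[) (cosh t * k nu z t) =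
  nu * besselK nu z + z * besselK (1 - nu) z.
Proof.
move=> nu01 z0; have nu01' : 0 <= 1 - nu <= 1 by case/andP: nu01; lra.
have ik := integrable_k nu01 z0.
have ik' := integrable_k nu01' z0.
have ick := integrable_coshk nu01 z0.
pose F t : R := expR (- z * cosh t) * sinh (nu * t).
pose f t : R := nu * k nu z t + (z * k (1 - nu) z t - z * (cosh t * k nu z t)).
have dF (t : R) : is_derive t 1 F (f t).
  have := is_deriveM (is_derive_expR_cosh (- z) t) (is_derive_sinhZ nu t).
  move=> d; apply: is_derive_eq d _.
  rewrite /GRing.scale/= /f /k (_ : (1 - nu) * t = t - nu * t); last by ring.
  by rewrite coshB; ring.
have cf : continuous f.
  move=> t; apply: cvgD; first by apply: cvgMr; exact: continuous_k.
  apply: cvgB; apply: cvgMr; first exact: continuous_k.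
  exact: continuous_coshk.
have fb t : 0 <= t -> `|f t| <=
    (nu * (48 / z ^+ 4) + (z * (48 / z ^+ 4) + z * (48 / z ^+ 4))) * expR (- t).
  move=> t0; have nu0 : 0 <= nu by case/andP: nu01.
  set e := 48 / z ^+ 4.
  rewrite (_ : _ * expR (- t) = nu * (e * expR (- t)) +
    (z * (e * expR (- t)) + z * (e * expR (- t)))); last by ring.
  apply: le_trans (ler_normD _ _) _; apply: lerD.
    rewrite normrM ger0_norm//; apply: ler_wpM2l => //.
    exact: k_bound.
  apply: le_trans (ler_normB _ _) _; apply: lerD.
    rewrite normrM gtr0_norm// ler_pM2l//.
    exact: k_bound.
  rewrite normrM gtr0_norm// ler_pM2l//.
  exact: coshk_bound.
have F0 : F t @[t --> +oo] --> 0.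
  have C1 : (fun t => 48 / z ^+ 4 * expR (- t)) @ +oo --> (0 : R).
    by rewrite -(mulr0 (48 / z ^+ 4)); apply: cvgMr; exact: cvgr_expR.
  apply: (squeeze_cvgr _ (@cvg_cst _ (0:R) _ _ _) C1); near=> t.
  have t0 : 0 <= t by [].
  have nut0 : 0 <= nu * t by rewrite mulr_ge0//; case/andP: nu01.
  rewrite mulr_ge0 ?expR_ge0 ?sinh_ge0//=.
  apply: le_trans (k_bound nu01 z0 t0); apply: le_trans (ler_norm _).
  by apply: ler_wpM2l; [exact: expR_ge0|exact: sinh_le_cosh].
have := Rintegral_FTC2y_dominated cf fb dF F0.
rewrite /F mulr0 sinh0 mulr0 subrr /f.
have iZ c (h : R -> R) : mu.-integrable `[0, +oo[ (EFin \o h) ->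
    mu.-integrable `[0, +oo[ (EFin \o (fun t => c * h t)).
  move=> ih; have := @integrableZl _ _ _ mu _ (measurable_itv _) c _ ih.
  by apply: eq_integrable => // t _; rewrite /= EFinM.
rewrite RintegralD//; last 2 first.
- exact: iZ.
- have := @integrableB _ _ _ mu _ (measurable_itv _) _ _ (iZ z _ ik') (iZ z _ ick).
  by apply: eq_integrable => // t _; rewrite /= EFinB.
rewrite RintegralB//; [|exact: iZ|exact: iZ].
rewrite !RintegralZl//.
have E n : \int[mu]_(x in `[0, +oo[) k n z x = besselK n z by [].
rewrite !E; lra.
Unshelve. all: by end_near. Qed.

Lemma is_derive_besselK nu z : 0 <= nu <= 1 -> 0 < z ->
  is_derive z 1 (besselK nu) (- (besselK (1 - nu) z + nu / z * besselK nu z)).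
Proof.
move=> nu01 z0; have E := besselK_rec nu01 z0.
apply: is_derive_eq (is_derive_besselK_int nu01 z0) _; congr (- _).
apply: (mulfI (lt0r_neq0 z0)); rewrite E.
by field; rewrite gt_eqF.
Qed.

End besselK.

(** * The two solutions *)

Section solutions.
Context {R : realType}.
Variables (tau B alpha s : R).
Hypotheses (tau_gt0 : 0 < tau) (B_gt0 : 0 < B) (s_gt0 : 0 < s).
Hypotheses (alpha_ge0 : 0 <= alpha) (alpha_le1 : alpha <= 1).

Let w := Num.sqrt (tau * s ^+ 2 + s).
Let r := Num.sqrt B.

Let w2_gt0 : 0 < tau * s ^+ 2 + s.
Proof. by apply: addr_gt0 => //; apply: mulr_gt0 => //; exact: exprn_gt0. Qed.

Let w_gt0 : 0 < w. Proof. by rewrite sqrtr_gt0. Qed.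

Let r_gt0 : 0 < r. Proof. by rewrite sqrtr_gt0. Qed.

Let w2E : tau * s ^+ 2 + s = w ^+ 2.
Proof. by rewrite sqr_sqrtr// ltW. Qed.

Let r2E : B = r ^+ 2.
Proof. by rewrite sqr_sqrtr// ltW. Qed.

Lemma powR_diffusivity (c a x : R) :
  (B * expR (c * x)) `^ a = B `^ a * expR (c * a * x).
Proof.
by rewrite powRM ?expR_ge0 ?(ltW B_gt0)// -expRM mulrAC.
Qed.

Lemma powR_mul_powR1B (a : R) : B `^ (1 - a) * B `^ a = B.
Proof. by rewrite -powRD ?subrK ?powRr1 ?(ltW B_gt0)// (gt_eqF B_gt0) implybT. Qed.

Lemma cvg_expR_mul (c : R) : 0 < c -> expR (- c * x) @[x --> +oo] --> (0 : R).
Proof.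
move=> c0.
have h : c * x @[x --> +oo] --> +oo by exact: gt0_cvgMry c0 cvg_id.
have -> : (fun x => expR (- c * x)) = (fun y : R => expR (- y)) \o (fun x => c * x).
  by apply/funext => x /=; rewrite mulNr.
by apply: cvg_comp h _; exact: cvgr_expR.
Qed.

(** * The case [lambda > 0]: solution in terms of I *)

Section positive_rate.
Variable lambda : R.
Hypothesis lambda_gt0 : 0 < lambda.

Let b := w / (lambda * r).

Let b_gt0 : 0 < b. Proof. by rewrite divr_gt0// mulr_gt0. Qed.

(** The square of half the argument of I_(alpha - 1) in [phat1], hence the variable of
    [besselI_series]. *)
Let y x := b ^+ 2 * expR (- lambda * x).
Let A := (tau * s + 1) / (2 * r * w * b * besselI_series (alpha + 1) (b ^+ 2)).

Let is_derive_series_y beta (x : R) : 0 <= beta ->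
  is_derive x 1 (fun x => besselI_series beta (y x))
    (- lambda * y x * besselI_series (beta + 1) (y x)).
Proof.
move=> beta0.
have dy : is_derive x 1 y (b ^+ 2 * (- lambda * expR (- lambda * x))).
  by apply: is_derive_eq (is_deriveZ (b ^+ 2) (is_derive_expRZ (- lambda) x)) _.
apply: is_derive_eq (@is_derive1_comp _ (besselI_series beta) y _ _ _
  (is_derive_besselI_series _ beta0) dy) _.
by rewrite /y; ring.
Qed.

Let continuous_series_y beta : 0 <= beta ->
  continuous (fun x => besselI_series beta (y x)).
Proof.
by move=> b0; apply: is_derive1_continuous => x; exact: is_derive_series_y.
Qed.

Let continuous_exp (c : R) : continuous (fun x => expR (c * x)).
Proof. by apply: is_derive1_continuous => x; exact: is_derive_expRZ. Qed.

Let continuous_y : continuous y.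
Proof. by move=> x; apply: cvgMr; exact: continuous_exp. Qed.

Let series_gt0 : 0 < besselI_series (alpha + 1) (b ^+ 2).
Proof. by apply: besselI_series_gt0; rewrite ?exprn_ge0 ?(ltW b_gt0)// ltr_wpDl. Qed.

(** The power extracted from I_(alpha - 1) merges with the exponential prefactor: the rates
    [- (lambda / 2) * (1 + alpha)] and [- (lambda / 2) * (alpha - 1)] add up to [- lambda * alpha],
    which multiplication by D^alpha cancels. *)
Lemma phat1E x : phat1 tau B alpha lambda x s =
  A * expR (- lambda * alpha * `|x|) * besselI_series alpha (y `|x|).
Proof.
rewrite /phat1 -/w -/r; set X := `|x|.
set e := expR (- lambda * X / 2); have e0 : 0 < e by exact: expR_gt0.
have -> : 2 / (lambda * r) * e * w = 2 * (b * e).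
  by rewrite /b; field; rewrite !gt_eqF.
have -> : 2 / (lambda * r) * w = 2 * b.
  by rewrite /b; field; rewrite !gt_eqF.
have n1 : -1 <= alpha - 1 by rewrite lerBrDr addNr.
have n2 : -1 <= alpha by rewrite (le_trans _ alpha_ge0)// lerN10.
have be0 : 0 < 2 * (b * e) by apply: mulr_gt0 => //; exact: mulr_gt0 b_gt0 e0.
have b20 : 0 < 2 * b by exact: mulr_gt0.
rewrite (besselIE n1 be0) (besselIE n2 b20).
rewrite subrK ![2 * _ / 2](mulrAC 2) !divff// !mul1r.
rewrite (powRM _ (ltW b_gt0) (ltW e0)).
have -> : (b * e) ^+ 2 = y X.
  by rewrite exprMn /y /e -expRM_natl; congr (_ * expR _); field.
have -> : b `^ (alpha - 1) = b `^ alpha / b.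
  by rewrite powRB ?powRr1 ?(ltW b_gt0)// (gt_eqF b_gt0) implybT.
rewrite /e -expRM.
have -> : expR (- lambda * alpha * X) =
   expR (- (lambda / 2) * (1 + alpha) * X) * expR (- lambda * X / 2 * (alpha - 1)).
  by rewrite -expRD; congr expR; field.
have ba := powR_gt0 alpha b_gt0.
by rewrite /A; field; rewrite !gt_eqF.
Qed.

Lemma phat1_solution :
  laplace_CV_solution tau B alpha lambda s (fun x => phat1 tau B alpha lambda x s).
Proof.
have a1 : 0 <= alpha + 1 by rewrite addr_ge0.
have a2 : 0 <= alpha + 1 + 1 by rewrite addr_ge0.
pose p (x : R) := A * expR (- lambda * alpha * x) * besselI_series alpha (y x).
(* With [z] the argument of I, [q] is a constant multiple of [z^(1 - alpha) I_(alpha - 1)] and [h]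
   one of [z^alpha I_alpha]. *)
pose q (x : R) := B `^ alpha * A * besselI_series alpha (y x).
pose g (x : R) := B `^ alpha * A * (- lambda * y x * besselI_series (alpha + 1) (y x)).
pose h (x : R) := - lambda * b ^+ 2 * B * A *
  (expR (- lambda * alpha * x) * besselI_series (alpha + 1) (y x)).
have -> : (fun x => phat1 tau B alpha lambda x s) = (fun x => p `|x|).
  by apply/funext => x; rewrite phat1E.
apply: (@even_laplace_CV_solution _ _ _ _ _ _ p q g h).
- move=> x; apply: cvgM; last exact: continuous_series_y.
  by apply: cvgMr; exact: continuous_exp.
- move=> x; apply: cvgMr; apply: cvgM; last exact: continuous_series_y.
  by apply: cvgMr; exact: continuous_y.
- move=> x; rewrite powR_diffusivity /p /q.
  have := expR_mulN (lambda * alpha * x).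
  rewrite !mulNr; set e1 := expR _; set e2 := expR _ => e12.
  by rewrite -[RHS]mul1r -e12; ring.
- move=> x; apply: is_derive_eq (is_deriveZ (B `^ alpha * A) (is_derive_series_y x alpha_ge0)) _.
  by [].
- move=> x; rewrite powR_diffusivity /g /h /y.
  have -> : expR (- lambda * alpha * x) =
      expR (lambda * (1 - alpha) * x) * expR (- lambda * x).
    by rewrite -expRD; congr expR; ring.
  by rewrite -[in RHS](powR_mul_powR1B alpha); ring.
- move=> x.
  have := is_deriveM (is_derive_expRZ (- lambda * alpha) x) (is_derive_series_y x a1).
  move=> /(is_deriveZ (- lambda * b ^+ 2 * B * A)) d.
  apply: is_derive_eq d _.
  rewrite /GRing.scale/= /p (besselI_series_rec (y x) alpha_ge0) w2E.
  have -> : w ^+ 2 = lambda ^+ 2 * b ^+ 2 * B.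
    by rewrite r2E /b; field; rewrite !gt_eqF.
  move: (besselI_series (alpha + 1) (y x)) (besselI_series (alpha + 1 + 1) (y x)).
  move: (expR _) (y x) A (b ^+ 2) => e u c b2 S1 S2.
  by ring.
(* The denominator of [A] cancels the series at [b ^+ 2], and [lambda * b * r = w] settles the
   constants. *)
- rewrite /h /y !mulr0 expR0 mulr1 mul1r /A r2E.
  by rewrite /b; field; rewrite -/b !gt_eqF.
- have y0 : y x @[x --> +oo] --> 0.
    by rewrite -(mulr0 (b ^+ 2)); apply: cvgMr; exact: cvg_expR_mul.
  have Sy beta : 0 <= beta ->
      besselI_series beta (y x) @[x --> +oo] --> besselI_series beta 0.
    move=> beta0; apply: (cvg_comp _ _ y0).
    by apply: is_derive1_continuous => z; exact: is_derive_besselI_series.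
  (* For [alpha = 0] the exponential factor is constantly 1. Decay then comes from the series, whose
     constant term 1 / Gamma(0) vanishes, so that a factor [y x] comes out. *)
  have [a0|a0] := eqVneq alpha 0.
    have -> : p = (fun x => A * (y x * besselI_series (alpha + 1 + 1) (y x))).
      apply/funext => x.
      have e1 : expR (- lambda * alpha * x) = 1.
        by rewrite a0 mulr0 mul0r expR0.
      have e2 : alpha * besselI_series (alpha + 1) (y x) = 0.
        by rewrite {1}a0 mul0r.
      by rewrite /p e1 (besselI_series_rec _ alpha_ge0) e2 add0r mulr1.
    rewrite -(mulr0 A) -[in A * 0](mul0r (besselI_series (alpha + 1 + 1) 0)).
    by apply: cvgMr; apply: cvgM => //; exact: Sy.
  have {}a0 : 0 < alpha by rewrite lt_neqAle eq_sym a0.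
  have ey : expR (- lambda * alpha * x) @[x --> +oo] --> (0 : R).
    by rewrite mulNr; apply: cvg_expR_mul; exact: mulr_gt0.
  have cA : A * expR (- lambda * alpha * x) @[x --> +oo] --> A * 0.
    exact: cvgMr.
  have := cvgM cA (Sy alpha alpha_ge0).
  rewrite (mulr0 A) mul0r.
  exact.
Qed.

End positive_rate.

(** * The case [lambda < 0]: solution in terms of K *)

Section negative_rate.
Variable lambda : R.
Hypothesis lambda_lt0 : lambda < 0.

Let m := - lambda.

Let m_gt0 : 0 < m. Proof. by rewrite oppr_gt0. Qed.

Let a := 2 * w / (m * r).

Let a_gt0 : 0 < a. Proof. by rewrite divr_gt0// mulr_gt0. Qed.

Let z x := a * expR (m / 2 * x).

Let z_gt0 x : 0 < z x. Proof. by rewrite mulr_gt0// expR_gt0. Qed.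

Let A := (tau * s + 1) / (2 * r * w * besselK alpha a).

Let alpha01 : 0 <= alpha <= 1. Proof. exact/andP. Qed.

Let alpha01' : 0 <= 1 - alpha <= 1. Proof. by rewrite subr_ge0 alpha_le1 lerBlDr lerDl. Qed.

Let K_gt0 : 0 < besselK alpha a. Proof. exact: besselK_gt0. Qed.

(* This is [(z^nu K_nu)' = - z^nu K_(nu - 1)] composed with [z]. *)
Let is_derive_expR_besselK nu (x : R) : 0 <= nu <= 1 ->
  is_derive x 1 (fun x => expR (m / 2 * nu * x) * besselK nu (z x))
    (- (m / 2) * (expR (m / 2 * nu * x) * z x * besselK (1 - nu) (z x))).
Proof.
move=> nu01.
have dz : is_derive x 1 z (a * (m / 2 * expR (m / 2 * x))).
  by apply: is_derive_eq (is_deriveZ a (is_derive_expRZ (m / 2) x)) _.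
have dK := @is_derive1_comp _ (besselK nu) z _ _ _ (is_derive_besselK nu01 (z_gt0 x)) dz.
apply: is_derive_eq (is_deriveM (is_derive_expRZ (m / 2 * nu) x) dK) _.
have e0 := expR_gt0 (m / 2 * x).
by rewrite /GRing.scale/= /z; field; rewrite !gt_eqF.
Qed.

Let continuous_expR_besselK nu : 0 <= nu <= 1 ->
  continuous (fun x => expR (m / 2 * nu * x) * besselK nu (z x)).
Proof.
move=> nu01.
exact: (is_derive1_continuous (fun x => is_derive_expR_besselK x nu01)).
Qed.

Let continuous_exp (c : R) : continuous (fun x => expR (c * x)).
Proof. by apply: is_derive1_continuous => x; exact: is_derive_expRZ. Qed.

(** K is even in its order, so [alpha - 1] becomes [1 - alpha], within the range [0, 1] of the
    results on K. *)
Lemma phat2E x : phat2 tau B alpha lambda x s =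
  A * expR (m / 2 * (1 + alpha) * `|x|) * besselK (1 - alpha) (z `|x|).
Proof.
rewrite /phat2 -/w -/r normrM ltr0_norm// -/m.
have -> : 2 / (m * r) * expR (m * `|x| / 2) * w = z `|x|.
  rewrite /z (_ : m * `|x| / 2 = m / 2 * `|x|); last by ring.
  by rewrite /a; field; rewrite !gt_eqF.
have -> : 2 / (m * r) * w = a by rewrite /a; field; rewrite !gt_eqF.
rewrite -(opprB 1 alpha) besselKN /A.
by field; rewrite !gt_eqF.
Qed.

Lemma phat2_solution :
  laplace_CV_solution tau B alpha lambda s (fun x => phat2 tau B alpha lambda x s).
Proof.
(* Up to a constant this is [z^nu K_nu]; [q] uses it at order [1 - alpha] and [h] at order [alpha],
   and each derivative brings in the other order. *)
pose E nu (x : R) := expR (m / 2 * nu * x) * besselK nu (z x).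
pose p (x : R) := A * expR (m / 2 * (1 + alpha) * x) * besselK (1 - alpha) (z x).
pose q (x : R) := B `^ alpha * A * E (1 - alpha) x.
pose g (x : R) := B `^ alpha * A *
  (- (m / 2) * (expR (m / 2 * (1 - alpha) * x) * z x * besselK alpha (z x))).
pose h (x : R) := - (m / 2) * B * A * a * E alpha x.
have -> : (fun x => phat2 tau B alpha lambda x s) = (fun x => p `|x|).
  by apply/funext => x; rewrite phat2E.
apply: (@even_laplace_CV_solution _ _ _ _ _ _ p q g h).
- have -> : p = (fun x => A * expR (m * alpha * x) * E (1 - alpha) x).
    apply/funext => x; rewrite /p /E.
    have -> : expR (m / 2 * (1 + alpha) * x) =
        expR (m * alpha * x) * expR (m / 2 * (1 - alpha) * x).
      by rewrite -expRD; congr expR; field.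
    by rewrite !mulrA.
  move=> x; apply: cvgM; last exact: continuous_expR_besselK.
  by apply: cvgMr; exact: continuous_exp.
- have -> : g = (fun x => B `^ alpha * A * (- (m / 2)) * a *
      (expR (m * (1 - alpha) * x) * E alpha x)).
    apply/funext => x; rewrite /g /E /z.
    have -> : expR (m * (1 - alpha) * x) * (expR (m / 2 * alpha * x) * besselK alpha (a * expR (m / 2 * x))) =
       expR (m / 2 * (1 - alpha) * x) * expR (m / 2 * x) * besselK alpha (a * expR (m / 2 * x)).
      by rewrite mulrA -!expRD; congr (expR _ * _); field.
    by ring.
  move=> x; apply: cvgMr; apply: cvgM; first exact: continuous_exp.
  exact: continuous_expR_besselK.
- move=> x; rewrite powR_diffusivity /p /q /E.
  have -> : expR (m / 2 * (1 - alpha) * x) =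
      expR (lambda * alpha * x) * expR (m / 2 * (1 + alpha) * x).
    by rewrite -expRD; congr expR; rewrite /m; field.
  by ring.
- move=> x.
  have := is_derive_expR_besselK x alpha01'.
  rewrite (_ : 1 - (1 - alpha) = alpha); last by ring.
  move=> d; apply: is_derive_eq (is_deriveZ (B `^ alpha * A) d) _.
  by [].
- move=> x; rewrite powR_diffusivity /g /h /E /z.
  have -> : expR (m / 2 * alpha * x) = expR (lambda * (1 - alpha) * x) *
      expR (m / 2 * (1 - alpha) * x) * expR (m / 2 * x).
    by rewrite -!expRD; congr expR; rewrite /m; field.
  by rewrite -[in RHS](powR_mul_powR1B alpha); ring.
- move=> x.
  apply: is_derive_eq (is_deriveZ (- (m / 2) * B * A * a)
    (is_derive_expR_besselK x alpha01)) _.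
  rewrite /GRing.scale/= /p w2E.
  have -> : w ^+ 2 = m ^+ 2 * a ^+ 2 * B / 4.
    by rewrite r2E /a; field; rewrite !gt_eqF.
  have -> : expR (m / 2 * (1 + alpha) * x) =
      expR (m / 2 * alpha * x) * expR (m / 2 * x).
    by rewrite -!expRD; congr expR; field.
  by rewrite /z; field.
(* The denominator of [A] cancels K_alpha at [a], and [m * r * a = 2 * w] settles the constants. *)
- rewrite /h /E /z !mulr0 expR0 mulr1 mul1r /A r2E.
  move: (besselK alpha a) K_gt0 => K K0.
  by rewrite /a; field; rewrite !gt_eqF.
- have A0 : 0 <= A.
    by rewrite divr_ge0// ?mulr_ge0// ?ltW// addr_gt0// mulr_gt0.
  (* [besselK_le] decays like [expR (- 2 * m * x)], while the prefactor grows at most like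
     [expR (m * x)] as [alpha <= 1]; [expR (- m * x)] remains. *)
  pose c := A * (48 / a ^+ 4).
  have C1 : (fun x => c * expR (- m * x)) @ +oo --> (0 : R).
    by rewrite -(mulr0 c); apply: cvgMr; exact: cvg_expR_mul.
  apply: (squeeze_cvgr _ (@cvg_cst _ (0 : R) _ _ _) C1); near=> x.
  have x0 : 0 <= x by [].
  have K0 : 0 <= besselK (1 - alpha) (z x) by exact/ltW/besselK_gt0.
  have Ae0 : 0 <= A * expR (m / 2 * (1 + alpha) * x).
    by apply: mulr_ge0 => //; exact: expR_ge0.
  have eA : A * expR (m / 2 * (1 + alpha) * x) <= A * expR (m * x).
    apply: ler_wpM2l => //; rewrite ler_expR; apply: ler_wpM2r => //.
    rewrite -mulrA ler_piMr ?(ltW m_gt0)// mulrC ler_pdivrMr// mul1r.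
    by rewrite -[leRHS]/(1 + 1) lerD2l.
  apply/andP; split; first exact: mulr_ge0.
  apply: (@le_trans _ _ (A * expR (m * x) * (48 / z x ^+ 4))).
    by apply: ler_pM => //; exact: besselK_le.
  rewrite /z /c exprMn -expRM_natl.
  have -> : expR (- m * x) = (expR (m * x))^-1.
    by rewrite -expRN; congr expR; ring.
  have -> : expR (4 * (m / 2 * x)) = expR (m * x) ^+ 2.
    by rewrite -expRM_natl; congr expR; field.
  move: (expR (m * x)) (expR_gt0 (m * x)) => e e0.
  by rewrite le_eqVlt; apply/orP; left; apply/eqP; field; rewrite !gt_eqF.
Unshelve. all: by end_near. Qed.

End negative_rate.
End solutions.

Unset Implicit Arguments.

Theorem mainTheorem1 (R : realType) (tau B alpha lambda : R)
    (tau_gt0 : 0 < tau) (B_gt0 : 0 < B)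
    (alpha_ge0 : 0 <= alpha) (alpha_le1 : alpha <= 1)
    (lambda_neq0 : lambda != 0) :
  (0 < lambda -> forall s : R, 0 < s ->
     laplace_CV_solution tau B alpha lambda s
       (fun x => phat1 tau B alpha lambda x s)) /\
  (lambda < 0 -> forall s : R, 0 < s ->
     laplace_CV_solution tau B alpha lambda s
       (fun x => phat2 tau B alpha lambda x s)).
Proof.
by split=> ? s s_gt0; [exact: phat1_solution|exact: phat2_solution].
Qed.
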